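(* Let $(X,T)$ be an $M$-system. Then $(X,T)$ is either Banach-mean sensitive or Banach-mean equicontinuous.
   Context: A t.d.s. (topological dynamical system) is a pair $(X,T)$ where $X$ is a non-empty compact metric space with metric $d$ and $T\colon X\to X$ is continuous; $\mathbb{N}$ denotes the positive integers and $\mathbb{Z}_+$ the non-negative integers. $(X,T)$ is transitive if for all non-empty open $U,V\subset X$ there is $n\in\mathbb{N}$ with $T^nU\cap V\neq\emptyset$. A set $F\subset\mathbb{Z}_+$ is syndetic if there is $n\in\mathbb{N}$ with $F\cap\{m,m+1,\ldots,m+n\}\ne\emptyset$ for all $m\in\mathbb{Z}_+$. A point $x$ is minimal if for every neighbourhood $U$ of $x$ the set $\{n\in\mathbb{Z}_+:T^nx\in U\}$ is syndetic. An $M$-system is a transitive t.d.s. whose set of minimal points is dense. For a bounded sequence $(a_i)_{i\ge0}$ write $\limsup_{N-M\to\infty}\frac1{N-M}\sum_{i=M}^{N-1}a_i:=\limsup_{n\to\infty}\sup_{N-M=n}\frac1n\sum_{i=M}^{N-1}a_i$ (with $M\in\mathbb{Z}_+$). $(X,T)$ is Banach-mean equicontinuous if for every $x\in X$ and $\varepsilon>0$ there is $\delta>0$ such that for every $y\in X$ with $d(x,y)<\delta$ we have $\limsup_{N-M\to\infty}\frac1{N-M}\sum_{i=M}^{N-1}d(T^ix,T^iy)<\varepsilon$. $(X,T)$ is Banach-mean sensitive if there is $\delta>0$ such that for every non-empty open $U\subset X$ there are $x,y\in U$ with $\limsup_{N-M\to\infty}\frac1{N-M}\sum_{i=M}^{N-1}d(T^ix,T^iy)>\delta$.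 *)

(* Defs.v *)
From HB Require Import structures.
From mathcomp Require Import all_boot all_order all_algebra.
From mathcomp Require Import all_classical all_reals all_analysis.

Set Implicit Arguments.
Unset Strict Implicit.
Unset Printing Implicit Defensive.

Import Order.TTheory GRing.Theory Num.Theory.

Local Open Scope classical_set_scope.
Local Open Scope ring_scope.

Definition syndetic (F : set nat) : Prop :=
  exists2 n : nat, (0 < n)%N &
    forall m : nat, F `&` [set k | (m <= k <= m + n)%N] !=set0.

(* [limsup_n sup_{M >= 0} (1/n) sum_{M <= i < M+n} a i]; taking it in the
   extended reals keeps it meaningful without a boundedness hypothesis. The term
   n = 0 (equal to 0) does not affect the limit superior. *)
Definition banach_limsup_mean (R : realType) (a : nat -> R) : \bar R :=
  limn_esup (fun n : nat =>
    ereal_sup [set (n%:R^-1 * \sum_(M <= i < M + n) a i)%:E | M in [set: nat]]).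

Section dynamical_systems.
Context {R : realType} {X : metricType R}.
Implicit Types (T : X -> X) (x y : X).

Definition tds T : Prop :=
  [/\ [set: X] !=set0, compact [set: X] & continuous T].

Definition topologically_transitive T : Prop :=
  forall U V : set X, open U -> U !=set0 -> open V -> V !=set0 ->
    exists2 n : nat, (0 < n)%N & (iter n T @` U) `&` V !=set0.

Definition minimal_point T x : Prop :=
  forall U : set X, nbhs x U -> syndetic [set n | U (iter n T x)].

Definition M_system T : Prop :=
  [/\ tds T, topologically_transitive T & dense [set x | minimal_point T x]].

Definition banach_mean_dist T x y : \bar R :=
  banach_limsup_mean (fun i => mdist (iter i T x) (iter i T y)).

Definition banach_mean_equicontinuous T : Prop :=
  forall x (e : R), 0 < e -> exists2 d : R, 0 < d &
    forall y, mdist x y < d -> (banach_mean_dist T x y < e%:E)%E.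

Definition banach_mean_sensitive T : Prop :=
  exists2 d : R, 0 < d & forall U : set X, open U -> U !=set0 ->
    exists x y, [/\ U x, U y & (d%:E < banach_mean_dist T x y)%E].

End dynamical_systems.

(* Main.v *)
Require Import Defs.
From mathcomp Require Import all_boot all_order all_algebra.
From mathcomp Require Import all_classical all_reals all_analysis.
From mathcomp Require Import lra zify.

(** Write D for the Banach mean of the distance along two orbits.  If the system
is not Banach-mean sensitive, then for every e there is a non-empty open set on
which D stays below e.  A point whose orbit enters this set is a point of
e-equicontinuity, because D is insensitive to the first terms of the orbits.  So
it suffices that every orbit enters every non-empty open set; since minimal
points are dense, it is enough that every minimal point b lies in the closure of
every orbit ([minimal_point_in_every_orbit_closure]).

This last fact comes from an averaging argument, a form of unique ergodicity at
a fixed scale ([window_sum_almost_constant]): the average over the first n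
iterates of a 1-Lipschitz function f is, for large n, almost independent of the
starting point.
- By Baire's theorem, the bounds on D over a small open set can be made
  uniform on a smaller open set V: one threshold n0 works for all pairs of
  points of V and all windows of length at least n0 ([uniform_windows]).
- Take a minimal point u in V.  Its orbit returns to V with bounded gaps, so the
  averages of f over windows of length n along the orbit of u hardly depend on
  the position of the window, once n is large compared with the gaps.
- By transitivity, the orbit of some w in V shadows the first n iterates of an
  arbitrary point x.  As u and w are mean-close on the corresponding window, the
  average of f at x is close to an average along the orbit of u.
It is crucial that n0 is chosen before w: how late w comes close to x is not
controlled, and only windows at arbitrary positions can absorb this.

If a minimal point b had a ball of radius r free of the orbit of a, the function
max (0, r - d(., b)) would vanish on the orbit of a, while its averages
along the orbit of b are bounded below, as b returns near itself with bounded
gaps.  This contradicts the previous statement.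

The two alternatives exclude each other by the triangle inequality for D. *)

Set Implicit Arguments.
Unset Strict Implicit.
Unset Printing Implicit Defensive.

Import Order.TTheory GRing.Theory Num.Theory.

Local Open Scope classical_set_scope.
Local Open Scope ring_scope.

(** * Sums over windows of a real sequence *)

Section windows.
Context {R : realType}.
Implicit Types (a b : nat -> R) (e r : R) (M m n k : nat).

Definition window_sum a M n : R := \sum_(M <= i < M + n) a i.

Lemma window_sum_cat a M m n :
  window_sum a M (m + n) = window_sum a M m + window_sum a (M + m) n.
Proof.
by rewrite /window_sum (big_cat_nat _ (n := (M + m)%N)) ?addnA ?leq_addr.
Qed.

Lemma ler_window_sum a b M n :
  (forall i, (M <= i < M + n)%N -> a i <= b i) ->
  window_sum a M n <= window_sum b M n.
Proof. exact: ler_sum_nat. Qed.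

Lemma window_sum_cst e M n : window_sum (fun=> e) M n = n%:R * e.
Proof. by rewrite /window_sum sumr_const_nat addKn mulr_natl. Qed.

Lemma window_sumD a b M n :
  window_sum (fun i => a i + b i) M n = window_sum a M n + window_sum b M n.
Proof. exact: big_split. Qed.

Lemma window_sum_shift a k M n :
  window_sum (fun i => a (i + k)%N) M n = window_sum a (M + k) n.
Proof. by rewrite /window_sum addnAC big_addn addnK. Qed.

(** Two windows of the same length at distance [k] differ by [k] terms at each
end, so a bounded sequence cannot tell them apart once they are long. *)
Lemma ler_window_sumB a r M k n : (forall i, 0 <= a i <= r) ->
  `|window_sum a (M + k) n - window_sum a M n| <= k%:R * r.
Proof.
move=> ar.
have bd m : 0 <= window_sum a m k <= k%:R * r.
  rewrite sumr_ge0 => [|i _]; last by case/andP: (ar i).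
  by rewrite -(window_sum_cst r m) ler_window_sum// => i _; case/andP: (ar i).
have := window_sum_cat a M k n; rewrite addnC window_sum_cat => E.
have /andP[? ?] := bd M; have /andP[? ?] := bd (M + n)%N.
rewrite ler_norml; apply/andP; split; lra.
Qed.

(** A finitary form of the bound [e] on the Banach upper mean: unlike that
bound, it carries a threshold that can be shared by a family of sequences. *)
Definition windows_le a e n0 :=
  forall n M, (n0 <= n)%N -> window_sum a M n <= n%:R * e.

Lemma windows_leD a b e1 e2 n1 n2 : windows_le a e1 n1 -> windows_le b e2 n2 ->
  windows_le (fun i => a i + b i) (e1 + e2) (maxn n1 n2).
Proof.
move=> ae be n M; rewrite geq_max => /andP[n1n n2n].
by rewrite window_sumD mulrDr lerD ?ae ?be.
Qed.

Lemma banach_limsup_mean_lt_windows a e : (banach_limsup_mean a < e%:E)%E ->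
  exists n0, windows_le a e n0.
Proof.
move=> /ereal_inf_lt[_ [A [n0 _ n0A] <-]] lte; exists n0 => n M n0n.
have [->|n_gt0] := posnP n; first by rewrite /window_sum addn0 big_geq// mul0r.
rewrite -ler_pdivrMl ?ltr0n// -lee_fin; apply: le_trans (ltW lte).
apply: (le_trans _ (ereal_sup_ubound _)); last by exists n; [exact: n0A|].
by apply: ereal_sup_ubound; exists M.
Qed.

Lemma windows_banach_limsup_mean_le a e n0 : windows_le a e n0 ->
  (banach_limsup_mean a <= e%:E)%E.
Proof.
move=> ae; apply: le_trans (ereal_inf_lbound _) _.
  by exists [set n | (n0 < n)%N] => //; exists n0.+1.
apply: ge_ereal_sup => _ [n /= n0n <-]; apply: ge_ereal_sup => _ [M _ <-].
by rewrite lee_fin ler_pdivrMl ?ltr0n ?(leq_trans _ n0n)// ae// ltnW.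
Qed.

Lemma eventually_le_mul c e : 0 < e ->
  exists n0, forall n, (n0 <= n)%N -> c <= n%:R * e.
Proof.
move=> e_gt0; exists (Num.truncn (c / e)).+1 => n n0n.
rewrite -ler_pdivrMr//; apply: le_trans (ltW (truncnS_gt _)) _.
by rewrite ler_nat.
Qed.

(** The Banach upper mean ignores the first [k] terms: a window starting before
[k] is covered by a window of the same length starting at [k] or later, together
with terms whose indices are below [k + k], so that their total is bounded
independently of the window. *)
Lemma windows_le_shift a e k n0 : 0 < e -> (forall i, 0 <= a i) ->
  windows_le (fun i => a (i + k)%N) e n0 -> exists n1, windows_le a (e + e) n1.
Proof.
move=> e_gt0 a_ge0 ae.
pose c := window_sum a 0 (k + k).
have [n1 c_le] := eventually_le_mul c e_gt0.
exists (maxn n0 n1) => n M; rewrite geq_max mulrDr => /andP[n0n n1n].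
have wge m l : 0 <= window_sum a m l by exact: sumr_ge0.
(* A window starting before [k] is covered by its first [k] terms, all counted
   in [c], and the window of the same length starting at [M + k]. *)
have := c_le n n1n; have [kM|/ltnW Mk] := leqP k M.
  have := ae n (M - k)%N n0n; rewrite window_sum_shift subnK//.
  have := wge 0%N (k + k)%N; rewrite -/c; lra.
have := ae n M n0n; rewrite window_sum_shift.
have := window_sum_cat a M k n; rewrite addnC window_sum_cat.
have := window_sum_cat a 0 M (k + (k - M));
  rewrite [X in _ = _ + X]window_sum_cat !add0n.
have -> : (M + (k + (k - M)) = k + k)%N by lia.
rewrite -/c; have := wge (M + n)%N k; have := wge 0%N M.
have := wge (M + k)%N (k - M)%N; lra.
Qed.

End windows.

(** * Baire's theorem for compact uniform spaces *)

Section baire.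
Context {X : uniformType}.

(** Otherwise every non-empty open subset of [U] contains a point outside [F n],
hence, by regularity, a non-empty open set with closure avoiding [F n].
Iterating gives nested open sets, and compactness a point in all their closures:
it lies in [U] but in no [F n]. *)
Lemma compact_Baire (U : set X) (F : nat -> set X) :
  compact [set: X] -> open U -> U !=set0 -> (forall n, closed (F n)) ->
  U `<=` \bigcup_n F n ->
  exists n V, [/\ open V, V !=set0 & V `<=` U `&` F n].
Proof.
move=> cX oU U0 cF UF; apply: contrapT => noV.
have step (p : nat * set X) : exists V' : set X,
    open p.2 -> p.2 !=set0 -> p.2 `<=` U ->
    [/\ open V', V' !=set0 & closure V' `<=` p.2 `&` ~` F p.1].
  case: p => n V /=; have [[oV V0 VU]|nV] := pselect
    [/\ open V, V !=set0 & V `<=` U]; last first.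
    by exists set0 => oV V0 VU; exfalso; apply: nV.
  have [x Vx nFx] : exists2 x, V x & ~ F n x.
    apply: contrapT => nx; apply: noV; exists n, V; split => // x Vx; split.
      exact: VU.
    by apply: contrapT => Fx; apply: nx; exists x.
  have /uniform_regular[B Bx clB] : nbhs x (V `&` ~` F n).
    apply: open_nbhs_nbhs; split => //; apply: openI => //.
    exact: closed_openC.
  exists B° => _ _ _; split; [exact: open_interior|by exists x|].
  by apply: subset_trans clB; apply: closureS; exact: interior_subset.
have [g gP] := choice step.
pose fix W n := if n is n'.+1 then g (n', W n') else U.
have WP n : [/\ open (W n), W n !=set0 & W n `<=` U].
  elim: n => [|n [oW W0 WU]]; first by split.
  have [oW1 W10 clW] := gP (n, W n) oW W0 WU; split => //.
  by move=> x /subset_closure/clW[/WU].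
have clW n : closure (W n.+1) `<=` W n `&` ~` F n.
  by have [oW W0 WU] := WP n; have [] := gP (n, W n) oW W0 WU.
have Wle m n : (m <= n)%N -> W n `<=` W m.
  move=> /subnK <-; elim: (n - m)%N => [//|k IH].
  by move=> x /subset_closure/clW[/IH].
have [x Wx] : {x : nat -> X & forall n, W n (x n)}.
  by apply: choice => n; have [_ [y]] := WP n; exists y.
have [p [_ xp]] := cX (x @ \oo) _ filterT.
have Wp n : closure (W n) p.
  rewrite clusterE in xp; apply: xp; exists n => // m /= nm.
  exact: Wle (Wx m).
have Up : U p by have [] := clW 0%N p (Wp 1%N).
have [n _ Fnp] := UF p Up.
by have [] := clW n p (Wp n.+1).
Qed.
End baire.

(** * Averages along orbits *)

Section dynamics.
Context {R : realType} {X : metricType R}.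
Variable T : X -> X.
Implicit Types (x y u v w : X) (e r : R) (U V : set X).

Definition orbit_dist x y : nat -> R :=
  fun i => mdist (iter i T x) (iter i T y).

Lemma orbit_dist_sym x y : orbit_dist x y = orbit_dist y x.
Proof. by apply/funext => i; exact: metric_sym. Qed.

Lemma windows_le_orbit_dist_trans x y z e1 e2 n1 n2 :
  windows_le (orbit_dist x y) e1 n1 -> windows_le (orbit_dist y z) e2 n2 ->
  windows_le (orbit_dist x z) (e1 + e2) (maxn n1 n2).
Proof.
move=> xy yz n M Nn; apply: le_trans (windows_leD xy yz M Nn).
by apply: ler_window_sum => i _; exact: metric_triangle.
Qed.

Lemma window_sum_lipschitz (f : X -> R) x y M n :
  (forall x y, `|f x - f y| <= mdist x y) ->
  `|window_sum (fun i => f (iter i T x)) M n -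
    window_sum (fun i => f (iter i T y)) M n| <=
  window_sum (orbit_dist x y) M n.
Proof.
move=> fL; rewrite /window_sum -sumrB; apply: le_trans (ler_norm_sum _ _ _) _.
by apply: ler_sum => i _; exact: fL.
Qed.

Lemma window_sum_iter (f : X -> R) k x M n :
  window_sum (fun i => f (iter i T (iter k T x))) M n =
  window_sum (fun i => f (iter i T x)) (M + k) n.
Proof. by rewrite -window_sum_shift; under eq_fun do rewrite -iterD. Qed.

Hypothesis cT : continuous T.

Lemma continuous_iter k : continuous (iter k T).
Proof.
elim: k => [|k IH] x; first exact: cvg_id.
by apply: (@continuous_comp _ _ _ (iter k T) T); [exact: IH|exact: cT].
Qed.

Lemma near_orbit x n e : 0 < e -> \forall y \near x,
  forall i, (i < n)%N -> orbit_dist x y i < e.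
Proof.
move=> e_gt0; elim: n => [|n IH]; first exact: nearW.
have nxt : \forall y \near x, orbit_dist x y n < e.
  exact: metricType_numDomainType.cvgr_dist_lt (@continuous_iter n x) _ e_gt0.
near=> y => i; rewrite ltnS leq_eqVlt => /orP[/eqP ->|].
  by near: y; exact: nxt.
by move: i; near: y; exact: IH.
Unshelve. all: by end_near. Qed.

(** Each condition involves finitely many iterates, which depend continuously on
the point. *)
Lemma closed_windows_le u e n0 :
  closed [set v | windows_le (orbit_dist u v) e n0].
Proof.
move=> p clp n M n0n; apply/ler_addgt0Pl => c c_gt0.
have c'_gt0 : 0 < c / n.+1%:R by rewrite divr_gt0.
have [v [/(_ n M n0n) vP pv]] := clp _ (near_orbit p (M + n) c'_gt0).
have le_c : n%:R * (c / n.+1%:R) <= c.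
  by rewrite mulrCA ler_piMr ?(ltW c_gt0)// ler_pdivrMr ?ltr0n// mul1r ler_nat.
rewrite addrC; apply: le_trans (lerD vP le_c).
rewrite -(window_sum_cst (c / n.+1%:R) M) -window_sumD.
apply: ler_window_sum => i /andP[_ iMn].
apply: le_trans (metric_triangle _ (iter i T v) _) _.
by rewrite lerD2l metric_sym ltW// pv.
Qed.

Hypothesis cX : compact [set: X].

(** Fix [u] in [U]: the points of [U] that are mean-close to [u] from the
threshold [n0] on form closed sets which cover [U] when [n0] varies, so one of them
contains an open set by Baire's theorem.  Comparing two points of it through [u]
doubles the constant. *)
Lemma uniform_windows U e : open U -> U !=set0 ->
  (forall x y, U x -> U y -> (banach_mean_dist T x y < e%:E)%E) ->
  exists V n0, [/\ open V, V !=set0, V `<=` U &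
    forall v w, V v -> V w -> windows_le (orbit_dist v w) (e + e) n0].
Proof.
move=> oU [u Uu] Ue.
have [|n0 [V [oV V0 VF]]] :=
  compact_Baire cX oU (ex_intro _ u Uu) (@closed_windows_le u e).
  move=> v Uv; have [n0 uv] := banach_limsup_mean_lt_windows (Ue u v Uu Uv).
  by exists n0.
exists V, n0; split => // [v /VF[]//|v w /VF[_ uv] /VF[_ uw]].
rewrite -(maxnn n0); apply: windows_le_orbit_dist_trans uw.
by rewrite orbit_dist_sym.
Qed.

Hypothesis trT : topologically_transitive T.
Hypothesis dT : dense [set x | minimal_point T x].
(* This is what the failure of Banach-mean sensitivity provides. *)
Hypothesis smallT : forall e, 0 < e -> exists U, [/\ open U, U !=set0 &
  forall x y, U x -> U y -> (banach_mean_dist T x y < e%:E)%E].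

(** All the averages are compared with those of one minimal point [u] that
returns with bounded gaps to an open set [V] of mean-close points: [u] is compared with
its own returns to move windows along its orbit, and with a point of [V] whose
orbit shadows that of [x]. *)
Lemma window_sum_almost_constant (f : X -> R) r e :
  (forall x, 0 <= f x <= r) -> (forall x y, `|f x - f y| <= mdist x y) ->
  0 < e -> exists n0, forall n x y, (n0 <= n)%N ->
  `|window_sum (fun i => f (iter i T x)) 0 n -
    window_sum (fun i => f (iter i T y)) 0 n| <= n%:R * e.
Proof.
(* Each of [x] and [y] costs [4 * c]: [c] for shadowing, [c] for passing to [u],
   and [2 * c] for moving the window back to the start of the orbit of [u]. *)
move=> fr fL e_gt0; pose c := e / 8.
have c_gt0 : 0 < c by rewrite divr_gt0.
have c2_gt0 : 0 < c / 2 by rewrite divr_gt0.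
have [U [oU U0 Uc]] := smallT c2_gt0.
have [V [n0 [oV V0 VU]]] := uniform_windows oU U0 Uc.
rewrite -splitr => Vc.
have [u [Vu /(_ V)]] := dT V0 oV.
case; first exact: open_nbhs_nbhs.
move=> N N_gt0 Nret.
have [n1 n1c] := eventually_le_mul (N%:R * r) c_gt0.
exists (maxn n0 n1) => n; rewrite /= geq_max => + + /andP[n0n n1n].
pose S x m := window_sum (fun i => f (iter i T x)) m n.
suff Su x : `|S u 0%N - S x 0%N| <= 4 * (n%:R * c).
  move=> x y; have := Su x; have := Su y.
  have -> : n%:R * e = 8 * (n%:R * c) by rewrite /c; lra.
  rewrite -/(S x 0%N) -/(S y 0%N) !ler_norml => /andP[? ?] /andP[? ?].
  by apply/andP; split; lra.
have Vn v w M : V v -> V w -> `|S v M - S w M| <= n%:R * c.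
  move=> Vv Vw; apply: le_trans (window_sum_lipschitz _ _ _ _ fL) _.
  exact: Vc n0n.
have Suu m : `|S u m - S u 0%N| <= 2 * (n%:R * c).
  have [k [/= Vk /andP[mk kmN]]] := Nret m.
  have : `|S u k - S u 0%N| <= n%:R * c.
    by have := Vn _ _ 0%N Vk Vu; rewrite /S window_sum_iter add0n.
  have : `|S u k - S u m| <= n%:R * c.
    rewrite -(subnKC mk); apply: le_trans (ler_window_sumB _ _ _ _) _ => //.
    apply: le_trans (n1c _ n1n); apply: ler_wpM2r.
      by case/andP: (fr u); exact: le_trans.
    by rewrite ler_nat leq_subLR.
  rewrite !ler_norml => /andP[? ?] /andP[? ?].
  by apply/andP; split; lra.
pose W := [set y | forall i, (i < n)%N -> orbit_dist x y i < c]°.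
have W0 : W !=set0 by exists x; exact: near_orbit.
have [m _ [_ [[w Vw <-] /interior_subset/= xw]]] :=
  trT oV V0 (open_interior _) W0.
have : `|S x 0%N - S w m| <= n%:R * c.
  rewrite -(window_sum_cst c 0) -[m]add0n /S -window_sum_iter.
  apply: le_trans (window_sum_lipschitz _ _ _ _ fL) _.
  by apply: ler_window_sum => i /andP[_ iN]; exact/ltW/xw.
have := Vn _ _ m Vw Vu; have := Suu m.
rewrite !ler_norml => /andP[? ?] /andP[? ?] /andP[? ?].
by apply/andP; split; lra.
Qed.

(** The averages of the tent function [f] of radius [r] around [b] separate the
orbit of [a], where [f] vanishes, from the orbit of [b], which returns with
bounded gaps to the half ball, where [f] is at least [r / 2]. *)
Lemma minimal_point_in_every_orbit_closure a b r : minimal_point T b -> 0 < r ->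
  exists i, mdist (iter i T a) b < r.
Proof.
move=> minb r_gt0; apply: contrapT => noi.
have far i : r <= mdist (iter i T a) b.
  by rewrite leNgt; apply/negP => ?; apply: noi; exists i.
pose f x : R := Num.max 0 (r - mdist x b).
have f0 x : 0 <= f x <= r.
  rewrite /f le_max lexx /= ge_max (ltW r_gt0)/= lerBlDr lerDl.
  exact: mdist_ge0.
have fL x y : `|f x - f y| <= mdist x y.
  have h u v : f u - f v <= mdist u v.
    rewrite lerBlDr /f ge_max addr_ge0 ?mdist_ge0 ?le_max ?lexx//=.
    have := metric_triangle v u b; rewrite (metric_sym v u) => ?.
    rewrite -lerBlDl le_max; apply/orP; right; lra.
  by rewrite ler_norml h andbT lerNl opprB metric_sym h.
have r2_gt0 : 0 < r / 2 by rewrite divr_gt0.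
have fb x : mdist b x < r / 2 -> r / 2 <= f x.
  by move=> bx; rewrite /f le_max metric_sym; apply/orP; right; lra.
have [|p p_gt0 visit] := minb [set x | mdist b x < r / 2].
  by apply/metricType_numDomainType.nbhs_mdistP; exists (r / 2).
have block M : r / 2 <= window_sum (fun i => f (iter i T b)) M p.+1.
  have [k [/= bk /andP[Mk kMp]]] := visit M.
  have -> : p.+1 = ((k - M) + (1 + (p - (k - M))))%N by lia.
  rewrite !window_sum_cat subnKC//.
  have ge0 m n : 0 <= window_sum (fun i => f (iter i T b)) m n.
    by apply: sumr_ge0 => i _; case/andP: (f0 (iter i T b)).
  have E : window_sum (fun i => f (iter i T b)) k 1 = f (iter k T b).
    by rewrite /window_sum addn1 big_nat1.
  have := fb _ bk; have := ge0 M (k - M)%N.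
  have := ge0 (k + 1)%N (p - (k - M))%N; lra.
have blocks q : q%:R * (r / 2) <=
    window_sum (fun i => f (iter i T b)) 0 (q * p.+1).
  elim: q => [|q IH]; first by rewrite mul0r mul0n /window_sum big_geq.
  by rewrite mulSnr window_sum_cat -natr1 mulrDl mul1r lerD.
have e_gt0 : 0 < r / 4 / p.+1%:R by rewrite !divr_gt0.
have [n0 n0P] := window_sum_almost_constant f0 fL e_gt0.
have n0n : (n0 <= n0.+1 * p.+1)%N by nia.
have := n0P _ b a n0n; have := blocks n0.+1.
have -> : window_sum (fun i => f (iter i T a)) 0 (n0.+1 * p.+1) = 0.
  apply: big1_seq => i _; apply/max_idPl; rewrite subr_le0; exact: far.
have -> : (n0.+1 * p.+1)%:R * (r / 4 / p.+1%:R) = n0.+1%:R * (r / 4).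
  by rewrite natrM -mulrA [p.+1%:R * _]mulrC divfK// pnatr_eq0.
have : 0 < n0.+1%:R * r by rewrite mulr_gt0.
rewrite subr0 ler_norml => ? ? /andP[_]; lra.
Qed.

(** A small open set contains a minimal point, so the orbit of [x] enters it, and
so do the orbits of all points near [x], at the same time [k]; the first [k] terms
do not affect the Banach mean. *)
Lemma small_open_sets_equicontinuous : banach_mean_equicontinuous T.
Proof.
move=> x e e_gt0; pose c := e / 4.
have c_gt0 : 0 < c by rewrite divr_gt0.
have [U [oU U0 Uc]] := smallT c_gt0.
have [b [Ub minb]] := dT U0 oU.
have /metricType_numDomainType.nbhs_mdistP[r /= r_gt0 bU] : nbhs b U.
  exact: open_nbhs_nbhs.
have [k kr] := minimal_point_in_every_orbit_closure x minb r_gt0.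
have Uk : U (iter k T x) by apply: bU; rewrite /= metric_sym.
have : nbhs x (iter k T @^-1` U).
  by apply: continuous_iter; exact: open_nbhs_nbhs.
move=> /metricType_numDomainType.nbhs_mdistP[d /= d_gt0 dU].
exists d => // y /dU Uy.
have [n0 xy] := banach_limsup_mean_lt_windows (Uc _ _ Uk Uy).
have {}xy : windows_le (fun i => orbit_dist x y (i + k)) c n0.
  by move=> n M /(xy n M); under eq_fun do rewrite -!iterD.
have [|n1 {}xy] := windows_le_shift c_gt0 _ xy.
  by move=> i; exact: mdist_ge0.
apply: le_lt_trans (windows_banach_limsup_mean_le xy) _.
by rewrite lte_fin /c; lra.
Qed.

End dynamics.

(** * The dichotomy *)

Section dichotomy.
Context {R : realType} {X : metricType R}.
Variable T : X -> X.

Lemma not_sensitive_small_open_sets e : ~ banach_mean_sensitive T -> 0 < e ->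
  exists U : set X, [/\ open U, U !=set0 &
    forall x y, U x -> U y -> (banach_mean_dist T x y < e%:E)%E].
Proof.
move=> nsT e_gt0; apply: contrapT => noU; apply: nsT.
exists (e / 2) => [|U oU U0]; first by rewrite divr_gt0.
apply: contrapT => noxy; apply: noU; exists U; split => // x y Ux Uy.
rewrite ltNge; apply/negP => exy; apply: noxy; exists x, y; split => //.
by apply: lt_le_trans exy; rewrite lte_fin; lra.
Qed.

Lemma sensitive_not_equicontinuous : [set: X] !=set0 ->
  banach_mean_sensitive T -> ~ banach_mean_equicontinuous T.
Proof.
move=> [x _] [d d_gt0 sT] eT.
have d2_gt0 : 0 < d / 2 by rewrite divr_gt0.
have [r r_gt0 xr] := eT x _ d2_gt0.
pose U := [set y | mdist x y < r]°.
have Ux : U x by apply/metricType_numDomainType.nbhs_mdistP; exists r.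
have [y [z [Uy Uz]]] := sT U (open_interior _) (ex_intro _ x Ux).
have [n1 xy] := banach_limsup_mean_lt_windows (xr y (interior_subset Uy)).
have [n2 xz] := banach_limsup_mean_lt_windows (xr z (interior_subset Uz)).
apply/negP; rewrite -leNgt [d]splitr.
apply: windows_banach_limsup_mean_le; apply: windows_le_orbit_dist_trans xz.
rewrite orbit_dist_sym; exact: xy.
Qed.

End dichotomy.

Theorem corollary4p9 (R : realType) (X : metricType R) (T : X -> X)
    (MT : M_system T) :
  (banach_mean_sensitive T \/ banach_mean_equicontinuous T) /\
  ~ (banach_mean_sensitive T /\ banach_mean_equicontinuous T).
Proof.
have [[X0 cX cT] trT dT] := MT; split; last first.
  by move=> [sT]; exact: sensitive_not_equicontinuous.
have [|nsT] := pselect (banach_mean_sensitive T); [by left|right].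
apply: small_open_sets_equicontinuous => // e.
exact: not_sensitive_small_open_sets.
Qed.
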